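(* Let $G$ be a finite group with a homomorphism $s:G\to\{+1,-1\}$ (elements with $s(g)=-1$ are called anti-unitary, those with $s(g)=+1$ unitary), and let $M$ be a $d$-dimensional unitary projective (co-)representation of $(G,s)$ with factor system $\omega$ on $\mathbb{C}^d$. For a complex $d\times d$ matrix $X$ put $$\mathscr H=\sum_{g\in G}\big[M(g)\kappa_{s(g)}\big]\,(X+X^\dagger)\,\big[M(g)\kappa_{s(g)}\big]^{-1}.$$ Then, for random $X$ (i.e. for all $X\in\mathbb{C}^{d\times d}$ outside a set of Lebesgue measure zero), the matrix $\mathscr H$ is Hermitian and commutes with every operator $M(g)\kappa_{s(g)}$, $g\in G$, and every eigenspace of $\mathscr H$ is invariant under all the operators $M(g)\kappa_{s(g)}$ and, with respect to an orthonormal basis of that eigenspace, carries an irreducible unitary projective (co-)representation of $G$ that is contained in $M$.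
   Context: $\kappa$ denotes entrywise complex conjugation on $\mathbb{C}^d$ (an antilinear map). Set $\kappa_{s(g)}=I$ if $s(g)=+1$ and $\kappa_{s(g)}=\kappa$ if $s(g)=-1$. A unitary projective (co-)representation of $(G,s)$ of dimension $d$ with factor system $\omega:G\times G\to U(1)$ is a map $M:G\to U(d)$ such that for all $g_1,g_2\in G$ $$M(g_1)\kappa_{s(g_1)}\,M(g_2)\kappa_{s(g_2)}=\omega(g_1,g_2)\,M(g_1g_2)\,\kappa_{s(g_1g_2)}.$$ Consequently $\omega(g_1,g_2)\,\omega(g_1g_2,g_3)=\omega(g_2,g_3)^{s(g_1)}\,\omega(g_1,g_2g_3)$. The group is called unitary if $s$ is trivial, and anti-unitary if $s$ is nontrivial; in the latter case $G=H+T_0H$ with $H=\ker s$ and $T_0$ any fixed element with $s(T_0)=-1$. The representation is irreducible if $\mathbb{C}^d$ ($d\ge 1$) has no complex linear subspace, other than $0$ and $\mathbb{C}^d$, invariant under all operators $M(g)\kappa_{s(g)}$. An irreducible representation is contained in $M$ if it is equivalent to the restriction of $M$ to an invariant complex subspace of $\mathbb{C}^d$. *)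

(* Defs.v *)
From HB Require Import structures.
From mathcomp Require Import all_boot all_order all_fingroup all_algebra.
From mathcomp Require Import all_classical all_reals all_analysis.
From mathcomp.real_closed Require Export complex.

Set Implicit Arguments.
Unset Strict Implicit.
Unset Printing Implicit Defensive.
Import Order.TTheory GRing.Theory Num.Theory.
Local Open Scope ring_scope.
Local Open Scope sesquilinear_scope.

Section LebesgueMatrix.
Context {R : realType}.

(* n-fold product of the Lebesgue measure, on the product sigma-algebra of
   n.-tuple R; the one-point space R^0 has measure 1. *)
Fixpoint lebesgue_tuple (n : nat) :
    set (n.-tuple (measurableTypeR R)) -> \bar R :=
  match n with
  | 0 => dirac [tuple]
  | n'.+1 =>
      pushforward (@lebesgue_measure R \x lebesgue_tuple (n := n'))%E
        (fun p => [tuple of p.1 :: p.2])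
  end.

(* The identification of R^(2 d^2) with complex d x d matrices: the first d^2
   coordinates are the real parts of the entries, the last d^2 the imaginary
   parts. *)
Definition mx_of_coords (d : nat)
    (t : (d * d + d * d).-tuple (measurableTypeR R)) : 'M[R[i]]_d :=
  \matrix_(i, j) Complex (tnth t (lshift (d * d) (mxvec_index i j)) : R)
                         (tnth t (rshift (d * d) (mxvec_index i j)) : R).

Definition for_almost_all_mx (d : nat) (P : 'M[R[i]]_d -> Prop) : Prop :=
  (@lebesgue_tuple (d * d + d * d)).-negligible
    [set t | ~ P (mx_of_coords t)]%classic.

End LebesgueMatrix.

Section Coreps.
Context {R : realType} {gT : finGroupType}.
Local Notation C := (R[i]).

Definition sign_hom (s : gT -> int) : Prop :=
  (forall g, s g = 1 \/ s g = -1) /\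
  (forall g h, s (g * h)%g = s g * s h).

Definition kappa (e : int) (d : nat) (v : 'cV[C]_d) : 'cV[C]_d :=
  if e == 1 then v else map_mx Num.conj v.

Section Operators.
Variables (s : gT -> int) (d : nat) (M : gT -> 'M[C]_d).

(* The operator M(g) kappa_{s(g)} on C^d (column vectors). *)
Definition op (g : gT) (v : 'cV[C]_d) : 'cV[C]_d := M g *m kappa (s g) v.

(* Its inverse, kappa_{s(g)} M(g)^-1; see opK and opVK. *)
Definition opV (g : gT) (v : 'cV[C]_d) : 'cV[C]_d :=
  kappa (s g) (invmx (M g) *m v).

Definition corep (omega : gT -> gT -> C) : Prop :=
  [/\ forall g h, `|omega g h| = 1,
      forall g, M g \is unitarymx
    & forall g h v, op g (op h v) = omega g h *: op (g * h)%g v].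

Definition corep_invariant (U : {vspace 'cV[C]_d}) : Prop :=
  forall g v, v \in U -> op g v \in U.

Definition corep_irreducible : Prop :=
  (0 < d)%N /\
  forall U : {vspace 'cV[C]_d}, corep_invariant U -> U = 0%VS \/ U = fullv.

Definition sum_conj (X : 'M[C]_d) (v : 'cV[C]_d) : 'cV[C]_d :=
  \sum_(g : gT) op g ((X + X^t*) *m opV g v).

(* The conjugate of a complex linear map by an antilinear one is linear, so
   sum_conj X is given by a matrix, read off on the standard basis; see
   calHE. *)
Definition calH (X : 'M[C]_d) : 'M[C]_d :=
  \matrix_(i, j) sum_conj X (delta_mx j 0) i 0.

(* N(g) is such that N(g) kappa_{s(g)} is the operator M(g) kappa_{s(g)}
   expressed in the coordinates given by b. *)
Definition corep_in_basis (k : nat) (b : k.-tuple 'cV[C]_d) (g : gT) : 'M[C]_k :=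
  \matrix_(i, j) coord b i (op g (tnth b j)).

End Operators.

(* N is equivalent to the restriction of M to an invariant subspace U; the
   equivalence is the unitary map v |-> T *m v from C^k onto U. *)
Definition corep_contained (s : gT -> int) (k d : nat)
    (N : gT -> 'M[C]_k) (M : gT -> 'M[C]_d) : Prop :=
  exists (U : {vspace 'cV[C]_d}) (T : 'M[C]_(d, k)),
    [/\ corep_invariant s M U,
        T^t* *m T = 1%:M,
        limg (linfun (mulmx T : 'cV[C]_k -> 'cV[C]_d)) = U
      & forall g v, T *m op s N g v = op s M g (T *m v)].

Definition orthonormal_basis (d k : nat) (U : {vspace 'cV[C]_d})
    (b : k.-tuple 'cV[C]_d) : Prop :=
  basis_of U b /\
  forall i j, ((tnth b i)^t* *m tnth b j) 0 0 = (i == j)%:R.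

Lemma kappaK (e : int) (d : nat) : involutive (@kappa e d).
Proof.
move=> v; rewrite /kappa; case: (e == 1) => //.
by apply/matrixP => i j; rewrite !mxE conjCK.
Qed.

Lemma opK (s : gT -> int) (d : nat) (M : gT -> 'M[C]_d) (g : gT) :
  M g \is unitarymx -> cancel (op s M g) (opV s M g).
Proof. by move=> /unitarymx_unit Mu v; rewrite /opV /op mulKmx// kappaK. Qed.

Lemma opVK (s : gT -> int) (d : nat) (M : gT -> 'M[C]_d) (g : gT) :
  M g \is unitarymx -> cancel (opV s M g) (op s M g).
Proof. by move=> /unitarymx_unit Mu v; rewrite /opV /op kappaK mulKVmx. Qed.

Lemma calHE (s : gT -> int) (d : nat) (M : gT -> 'M[C]_d)
    (X : 'M[C]_d) (v : 'cV[C]_d) :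
  calH s M X *m v = sum_conj s M X v.
Proof.
have lin a (u w : 'cV[C]_d) :
    sum_conj s M X (a *: u + w) = a *: sum_conj s M X u + sum_conj s M X w.
  rewrite /sum_conj scaler_sumr -big_split; apply: eq_bigr => g _ /=.
  rewrite /op /opV /kappa; case: (s g == 1).
    by rewrite !mulmxDr -!scalemxAr.
  rewrite [invmx _ *m _]mulmxDr -scalemxAr map_mxD map_mxZ !mulmxDr.
  rewrite -!scalemxAr map_mxD map_mxZ mulmxDr -scalemxAr.
  by rewrite /= conjCK.
pose f := GRing.isLinear.Build _ _ _ _ (sum_conj s M X) lin.
pose L : {linear 'cV[C]_d -> 'cV[C]_d} := HB.pack (sum_conj s M X) f.
rewrite -[RHS]/(L v) [in RHS](matrix_sum_delta v) linear_sum.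
apply/matrixP => i j; rewrite (ord1 j) mxE summxE; apply: eq_bigr => k _.
by rewrite big_ord1 linearZ [LHS]mulrC ![in LHS]mxE [in RHS]mxE.
Qed.

End Coreps.

(* Main.v *)
(** By averaging, [calH] maps onto the real space A of Hermitian matrices that
    commute with all the operators.  Let m be the largest degree of the minimal
    polynomial, i.e. the largest number of distinct eigenvalues, of an element
    of A.  If H in A attains m, then its eigenspaces are irreducible: otherwise,
    with P the orthogonal projection onto a proper invariant subspace of the
    eigenspace of lambda, H + (mu - lambda) P is in A and has one more
    eigenvalue mu.  Attaining m means that 1, H, ..., H^(m-1) are linearly
    independent, which holds as soon as a certain determinant, polynomial in
    the real coordinates of X and not identically zero, does not vanish; by
    Fubini and induction on the number of variables, the zero set of such a
    polynomial is Lebesgue-null. *)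

Require Import Defs.
From HB Require Import structures.
From mathcomp Require Import all_boot all_order all_fingroup all_algebra.
From mathcomp Require Import all_classical all_reals all_analysis.
From mathcomp Require Import measurable_realfun.
Import Order.TTheory GRing.Theory Num.Theory.
Local Open Scope ring_scope.

(** * Zero sets of polynomial functions in real variables are Lebesgue-null *)

Section PolyFun.
Set Implicit Arguments.
Unset Strict Implicit.
Local Open Scope classical_set_scope.
Context {R : realType}.
Local Notation C := (R[i]).
Local Notation Rn n := (n.-tuple (measurableTypeR R)).

(** Polynomials with complex coefficients in real variables, given as a predicate on functions so
    that each property below follows by induction on the way the function is built. *)
Inductive poly_fun (n : nat) : (Rn n -> C) -> Prop :=
| poly_fun_cst c : poly_fun (fun=> c : C)
| poly_fun_coord k : poly_fun (fun t : Rn n => (tnth t k : R)%:C%C)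
| poly_funD (f g : Rn n -> C) : poly_fun f -> poly_fun g -> poly_fun (fun t => f t + g t)
| poly_funM (f g : Rn n -> C) : poly_fun f -> poly_fun g -> poly_fun (fun t => f t * g t).

(** The variables are real, so conjugation affects only the coefficients. Hence adjoints and
    conjugates of a matrix remain polynomial in its real coordinates. *)
Lemma poly_fun_conj n (f : Rn n -> C) : poly_fun f -> poly_fun (fun t => (f t)^*).
Proof.
elim=> [c|k|{}f g _ If _ Ig|{}f g _ If _ Ig].
- exact: poly_fun_cst.
- rewrite (_ : (fun _ => _) = (fun t : Rn n => (tnth t k : R)%:C%C)).
    exact: poly_fun_coord.
  by apply/funext => t; rewrite [LHS]conjc_real.
- by under eq_fun do rewrite rmorphD; apply: poly_funD.
- by under eq_fun do rewrite rmorphM; apply: poly_funM.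
Qed.

Lemma poly_fun_sum n (I : Type) (r : seq I) (P : pred I) (F : I -> Rn n -> C) :
  (forall i, P i -> poly_fun (F i)) ->
  poly_fun (fun t => \sum_(i <- r | P i) F i t).
Proof.
move=> PF; elim: r => [|i r IH].
  by under eq_fun do rewrite big_nil; apply: poly_fun_cst.
under eq_fun do rewrite big_cons.
by case: (boolP (P i)) => // Pi; apply: poly_funD => //; apply: PF.
Qed.

Lemma poly_fun_prod n (I : Type) (r : seq I) (F : I -> Rn n -> C) :
  (forall i, poly_fun (F i)) -> poly_fun (fun t => \prod_(i <- r) F i t).
Proof.
move=> PF; elim: r => [|i r IH].
  by under eq_fun do rewrite big_nil; apply: poly_fun_cst.
by under eq_fun do rewrite big_cons; apply: poly_funM.
Qed.

(** Real and imaginary parts go through the induction together, since each part of a product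
    involves both parts of the factors. *)
Lemma poly_fun_measurable n (f : Rn n -> C) : poly_fun f ->
  measurable_fun setT (fun t => complex.Re (f t)) /\
  measurable_fun setT (fun t => complex.Im (f t)).
Proof.
elim=> [c|k|{}f g _ [fr fi] _ [gr gi]|{}f g _ [fr fi] _ [gr gi]].
- by split; apply: measurable_cst.
- by split=> /=; [apply: measurable_tnth | apply: measurable_cst].
- under eq_fun do rewrite raddfD.
  under [X in _ /\ measurable_fun _ X]eq_fun do rewrite raddfD.
  by split; apply: measurable_funD.
- split.
    rewrite (_ : (fun _ => _) = (fun t =>
        complex.Re (f t) * complex.Re (g t) - complex.Im (f t) * complex.Im (g t))).
      by apply: measurable_funB; apply: measurable_realfun.measurable_funM.
    by apply/funext => t; case: (f t) => a b; case: (g t).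
  rewrite (_ : (fun _ => _) = (fun t =>
      complex.Re (f t) * complex.Im (g t) + complex.Im (f t) * complex.Re (g t))).
    by apply: measurable_funD; apply: measurable_realfun.measurable_funM.
  by apply/funext => t; case: (f t) => a b; case: (g t).
Qed.

Lemma poly_fun_zeros_measurable n (f : Rn n -> C) :
  poly_fun f -> measurable [set t | f t = 0].
Proof.
move=> /poly_fun_measurable[mr mi].
rewrite (_ : [set _ | _] = ((fun t => complex.Re (f t)) @^-1` [set 0])
    `&` ((fun t => complex.Im (f t)) @^-1` [set 0])).
  by apply: measurableI; rewrite -[X in measurable X]setTI; [apply: mr|apply: mi].
apply/seteqP; split => [t /= ->//|t [/= r0 i0]].
by apply/eqP; rewrite eq_complex r0 i0 !eqxx.
Qed.

Lemma poly_fun_section n (f : Rn n.+1 -> C) (x : R) : poly_fun f ->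
  poly_fun (fun t => f [tuple of x :: t]).
Proof.
elim=> [c|k|{}f g _ If _ Ig|{}f g _ If _ Ig].
- exact: poly_fun_cst.
- case: (unliftP ord0 k) => [j|] ->.
    by under eq_fun do rewrite tnthS; apply: poly_fun_coord.
  by under eq_fun do rewrite tnth0; apply: poly_fun_cst.
- exact: poly_funD.
- exact: poly_funM.
Qed.

Lemma poly_fun_univariate n (f : Rn n.+1 -> C) (t : Rn n) : poly_fun f ->
  exists p : {poly C}, forall x : R, f [tuple of x :: t] = p.[x%:C%C].
Proof.
elim=> [c|k|{}f g _ [p fp] _ [q gq]|{}f g _ [p fp] _ [q gq]].
- by exists c%:P => x; rewrite hornerC.
- case: (unliftP ord0 k) => [j|] ->.
    by exists ((tnth t j : R)%:C%C)%:P => x; rewrite tnthS hornerC.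
  by exists 'X => x; rewrite tnth0 hornerX.
- by exists (p + q) => x; rewrite fp gq hornerD.
- by exists (p * q) => x; rewrite fp gq hornerM.
Qed.

Lemma poly_real_roots_finite (p : {poly C}) : p != 0 ->
  finite_set [set x : R | p.[x%:C%C] = 0].
Proof.
move=> p0; apply: contrapT => inf.
have [A sA cA] := infinite_set_fset (size p) inf.
suff : (size [seq x%:C%C | x <- finmap.enum_fset A] < size p)%N.
  by rewrite size_map ltnNge cA.
apply: max_poly_roots => //.
  by apply/allP => _ /mapP[x xA ->]; apply/rootP; apply: sA.
by rewrite map_inj_uniq ?finmap.fset_uniq //; apply: complexI.
Qed.

Lemma lebesgue_tuple_ge0 n (A : set (Rn n)) : (0 <= lebesgue_tuple A)%E.
Proof.
elim: n A => [|n IH] A; first exact: measure_ge0.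
by apply: integral_ge0 => x _; apply: IH.
Qed.

(** Every preimage is finite or cofinite. This makes the measure of the sections a measurable
    function of the first coordinate without using that [lebesgue_tuple] is a measure. *)
Lemma measurable_finite_support (f : measurableTypeR R -> \bar R) :
  finite_set [set x | f x != 0%E] -> measurable_fun setT f.
Proof.
move=> fin _ Y _; rewrite setTI.
have mfin (A : set (measurableTypeR R)) : finite_set A -> measurable A.
  by move=> /finite_set_countable;
    apply: countable_measurable => t; apply: measurable_set1.
case: (pselect (Y 0%E)) => Y0.
  rewrite -[X in measurable X]setCK; apply: measurableC; apply: mfin.
  by apply: sub_finite_set fin => x /= Yfx; apply/eqP => fx; apply: Yfx; rewrite fx.
apply: mfin; apply: sub_finite_set fin => x /= Yfx; apply/eqP => fx; apply: Y0.
by rewrite -fx.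
Qed.

(** Induction on [n], integrating over the first coordinate [x]. With the tail of [t0] fixed, [f] is
    a nonzero polynomial [p] in [x]. Unless [x] is one of the finitely many real roots of [p], the
    section of [f] at [x] is nonzero at that tail, so its zero set is null by induction. *)
Lemma poly_fun_zeros_null n (f : Rn n -> C) t0 : poly_fun f -> f t0 != 0 ->
  lebesgue_tuple [set t | f t = 0] = 0%E.
Proof.
elim: n f t0 => [|n IH] f t0 pf ft0.
  rewrite /lebesgue_tuple diracE memNset //=.
  by rewrite -(tuple0 t0); apply/eqP.
have [p fp] := poly_fun_univariate (behead_tuple t0) pf.
have p0 : p != 0.
  apply: contraNneq ft0 => p0.
  by rewrite (tuple_eta t0)
    [X in f X](_ : _ = [tuple of thead t0 :: behead_tuple t0]) ?fp ?p0 ?horner0.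
pose m x := lebesgue_tuple [set t : Rn n | f [tuple of x :: t] = 0].
(* The pushforward of the product measure unfolds to the integral of the measures of the
   sections. *)
have mE : lebesgue_tuple [set t | f t = 0] = (\int[lebesgue_measure]_x m x)%E.
  apply: eq_integral => x _ /=; congr lebesgue_tuple.
  by apply/seteqP; split=> t; rewrite /xsection /= inE.
have fin := poly_real_roots_finite p0.
have m0 x : p.[x%:C%C] != 0 -> m x = 0%E.
  by rewrite -fp; apply: IH; apply: poly_fun_section.
pose N := [set x : measurableTypeR R | p.[(x : R)%:C%C] = 0].
have mN : measurable N.
  by apply: countable_measurable; [move=> t; apply: measurable_set1|
    apply: finite_set_countable].
rewrite mE; transitivity (\int[lebesgue_measure]_(x in setT `\` N) m x)%E; last first.
  by apply: integral0_eq => x [_ /= /eqP]; apply: m0.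
apply: (ge0_negligible_integral mN) => //.
- apply: measurable_finite_support; apply: sub_finite_set fin => x /= mx.
  by apply/eqP; apply: contraNT mx => /m0 ->.
- by move=> x _; apply: lebesgue_tuple_ge0.
- by apply: countable_lebesgue_measure0; apply: finite_set_countable.
Qed.

Lemma poly_fun_nonzero_ae n (f : Rn n -> C) (P : Rn n -> Prop) t0 :
  poly_fun f -> f t0 != 0 -> (forall t, f t != 0 -> P t) ->
  (@lebesgue_tuple R n).-negligible [set t | ~ P t].
Proof.
move=> pf f0 fP; exists [set t | f t = 0]; split.
- exact: poly_fun_zeros_measurable.
- exact: poly_fun_zeros_null f0.
- by move=> t /= nP; apply/eqP; apply: contra_notT nP => /fP.
Qed.
End PolyFun.

(** * Adjoints and entrywise conjugation of matrices *)

Section Twist.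
Set Implicit Arguments.
Unset Strict Implicit.
Local Open Scope sesquilinear_scope.
Context {R : realType}.
Local Notation C := (R[i]).

Lemma eq_mulmx_col m n (A B : 'M[C]_(m, n)) :
  (forall v : 'cV[C]_n, A *m v = B *m v) -> A = B.
Proof.
move=> AB; apply/matrixP => i j; have := AB (delta_mx j 0).
by rewrite -!colE => /matrixP/(_ i 0); rewrite !mxE.
Qed.

Lemma adjmxM m n p (A : 'M[C]_(m, n)) (B : 'M[C]_(n, p)) : (A *m B)^t* = B^t* *m A^t*.
Proof. by rewrite trmx_mul map_mxM. Qed.

Lemma adjmxK m n (A : 'M[C]_(m, n)) : A^t*^t* = A.
Proof. by apply/matrixP => i j; rewrite !mxE conjCK. Qed.

Lemma adjmxD m n (A B : 'M[C]_(m, n)) : (A + B)^t* = A^t* + B^t*.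
Proof. by apply/matrixP => i j; rewrite !mxE rmorphD. Qed.

Lemma adjmxZ m n a (A : 'M[C]_(m, n)) : (a *: A)^t* = a^* *: A^t*.
Proof. by apply/matrixP => i j; rewrite !mxE rmorphM. Qed.

(* twist e A is the matrix of kappa_e o A o kappa_e. *)
Definition twist (e : int) m n (A : 'M[C]_(m, n)) :=
  if e == 1 then A else map_mx Num.conj A.

Lemma twistM e m n p (A : 'M[C]_(m, n)) (B : 'M[C]_(n, p)) :
  twist e (A *m B) = twist e A *m twist e B.
Proof. by rewrite /twist; case: ifP => // _; rewrite map_mxM. Qed.

Lemma twistD e m n (A B : 'M[C]_(m, n)) : twist e (A + B) = twist e A + twist e B.
Proof. by rewrite /twist; case: ifP => // _; rewrite map_mxD. Qed.

Lemma twist0 e m n : twist e (0 : 'M[C]_(m, n)) = 0.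
Proof. by rewrite /twist; case: ifP => // _; rewrite map_mx0. Qed.

Lemma twist_sum e m n (I : finType) (F : I -> 'M[C]_(m, n)) :
  twist e (\sum_i F i) = \sum_i twist e (F i).
Proof. exact: (big_morph _ (@twistD e m n) (@twist0 e m n)). Qed.

Lemma twist1 e n : twist e (1%:M : 'M[C]_n) = 1%:M.
Proof. by rewrite /twist; case: ifP => // _; rewrite map_mx1. Qed.

Lemma twist_adj e m n (A : 'M[C]_(m, n)) : twist e (A^t*) = (twist e A)^t*.
Proof. by rewrite /twist; case: ifP => // _; rewrite map_trmx. Qed.

Lemma twistK e m n : involutive (@twist e m n).
Proof.
move=> A; rewrite /twist.
by case: (e == 1) => //; apply/matrixP => i j; rewrite !mxE conjCK.
Qed.

Lemma twist_realZ e m n (a : C) (A : 'M[C]_(m, n)) :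
  a^* = a -> twist e (a *: A) = a *: twist e A.
Proof. by rewrite /twist; case: ifP => // _ aR; rewrite map_mxZ /= aR. Qed.

Lemma twist_twist (e f : int) m n (A : 'M[C]_(m, n)) :
  e = 1 \/ e = -1 -> f = 1 \/ f = -1 -> twist e (twist f A) = twist (e * f) A.
Proof.
have K := twistK (-1) A.
by move=> [->|->] [->|->].
Qed.
End Twist.

(** * Co-representations in matrix form, and averaging over the group *)

Section Corep.
Set Implicit Arguments.
Unset Strict Implicit.
Local Open Scope sesquilinear_scope.
Context {R : realType} {gT : finGroupType} (s : gT -> int).
Local Notation C := (R[i]).
Hypothesis sP : sign_hom s.

Lemma twist_signM g h m n (A : 'M[C]_(m, n)) :
  twist (s g) (twist (s h) A) = twist (s (g * h)%g) A.
Proof. by case: sP => s1 sM; rewrite sM twist_twist. Qed.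

Lemma opE d (M : gT -> 'M[C]_d) g v : op s M g v = M g *m twist (s g) v.
Proof. by []. Qed.

(** Commutation with M(g) kappa once kappa is moved to the right and cancelled, using kappa A =
    twist(A) kappa. *)
Definition commutes d (M : gT -> 'M[C]_d) (A : 'M[C]_d) :=
  forall g, A *m M g = M g *m twist (s g) A.

Lemma corepP d (M : gT -> 'M[C]_d) omega :
  corep s M omega <->
  [/\ forall g h, `|omega g h| = 1,
      forall g, (M g)^t* *m M g = 1%:M
    & forall g h, M g *m twist (s g) (M h) = omega g h *: M (g * h)%g].
Proof.
split=> -[w1 Mu MM]; split=> //.
- by move=> g; apply: mulmx1C; apply/unitarymxP.
- move=> g h; apply: eq_mulmx_col => v.
  (* The test vector is twisted beforehand so that all conjugations acting on it cancel. *)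
  have /= := MM g h (twist (s (g * h)%g) v); rewrite !opE twistM.
  by rewrite twist_signM twistK mulmxA -scalemxAl.
- by move=> g; apply/unitarymxP; apply: mulmx1C.
- move=> g h v; rewrite !opE twistM mulmxA MM.
  by rewrite twist_signM -scalemxAl.
Qed.

Section Averaging.
Variables (d : nat) (M : gT -> 'M[C]_d) (omega : gT -> gT -> C).
Hypothesis MP : corep s M omega.

Let MtM g : (M g)^t* *m M g = 1%:M. Proof. by case/corepP: MP. Qed.
Let MMt g : M g *m (M g)^t* = 1%:M. Proof. exact: mulmx1C. Qed.

Lemma calH_mx X :
  calH s M X = \sum_g M g *m twist (s g) (X + X^t*) *m (M g)^t*.
Proof.
apply: eq_mulmx_col => v; rewrite calHE /sum_conj mulmx_suml.
apply: eq_bigr => g _; rewrite opE.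
rewrite (_ : opV _ _ _ _ = twist (s g) (invmx (M g) *m v)) // twistM twistK.
by rewrite invmx_unitary ?mulmxA //; case: MP.
Qed.

Lemma calH_adj X : (calH s M X)^t* = calH s M X.
Proof.
rewrite calH_mx raddf_sum raddf_sum; apply: eq_bigr => g _ /=.
by rewrite !adjmxM adjmxK -twist_adj adjmxD adjmxK addrC mulmxA.
Qed.

(** Conjugation by the operator of [h] sends the summand of [g] to that of [h * g], hence permutes
    the sum. *)
Lemma calH_commutes X : commutes M (calH s M X).
Proof.
have [w1 _ MM] := (corepP M omega).1 MP.
move=> h; set Z := X + X^t*; set F := fun g => M g *m twist (s g) Z *m (M g)^t*.
have HF : calH s M X = \sum_g F g by exact: calH_mx.
have FM g : F (h * g)%g = M h *m twist (s h) (F g) *m (M h)^t*.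
  (* The phase brought in by M(hg) has modulus 1 and cancels against the one brought in by its
     adjoint. *)
  rewrite /F; have -> : M (h * g)%g = (omega h g)^* *: (M h *m twist (s h) (M g)).
    by rewrite MM scalerA mulrC -normCK w1 expr1n scale1r.
  rewrite adjmxZ conjCK -!scalemxAl -!scalemxAr scalerA -normCKC w1 expr1n.
  by rewrite scale1r adjmxM !twistM twist_signM twist_adj !mulmxA.
rewrite {1}HF (reindex_inj (mulgI h)) /= mulmx_suml HF twist_sum mulmx_sumr.
by apply: eq_bigr => g _; rewrite FM -mulmxA MtM mulmx1.
Qed.

Lemma calH_onto Y : Y^t* = Y -> commutes M Y -> exists X, calH s M X = Y.
Proof.
(* All |G| summands for [c *: Y] equal 2c Y, so c = 1/(2|G|); being real, [c] is unaffected by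
   adjoints and twists. *)
move=> YH YM; pose c : C := (#|gT|%:R * 2)^-1.
have cR : c^* = c by rewrite /c fmorphV rmorphM !rmorph_nat.
exists (c *: Y); rewrite calH_mx.
have term g : M g *m twist (s g) (c *: Y + (c *: Y)^t*) *m (M g)^t* = (c * 2) *: Y.
  rewrite adjmxZ cR YH -scalerDl [c + c](_ : _ = c * 2) ?twist_realZ.
  - by rewrite -scalemxAr -YM -scalemxAl -mulmxA MMt mulmx1.
  - by rewrite rmorphM /= cR rmorph_nat.
  - by rewrite mulr_natr mulr2n.
rewrite (eq_bigr _ (fun g _ => term g)) sumr_const -scaler_nat scalerA.
rewrite [#|_|](_ : _ = #|gT|) ?(eq_card (B := gT)) // /c mulrCA mulVf ?scale1r //.
by rewrite mulf_neq0 ?pnatr_eq0 // -lt0n; apply/card_gt0P; exists 1%g.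
Qed.
End Averaging.
End Corep.

(** * Eigenvalues and minimal polynomials of Hermitian matrices *)

Section Hermitian.
Set Implicit Arguments.
Unset Strict Implicit.
Local Open Scope sesquilinear_scope.
Context {R : realType}.
Local Notation C := (R[i]).

Lemma adjmx_mul_eq0 n (v : 'cV[C]_n) : v^t* *m v = 0 -> v = 0.
Proof.
move=> /matrixP/(_ 0 0); rewrite !mxE => /eqP.
rewrite psumr_eq0 => [/allP v0|i _]; last by rewrite !mxE mulrC mul_conjC_ge0.
apply/colP => i; rewrite mxE; have := v0 i (mem_index_enum i).
by rewrite !mxE mulrC mul_conjC_eq0 => /eqP.
Qed.

Lemma herm_eigenvalue_real n (Y : 'M[C]_n) x (v : 'cV[C]_n) :
  Y^t* = Y -> v != 0 -> Y *m v = x *: v -> x^* = x.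
Proof.
move=> YH v0 Yv; have : v^t* *m (Y *m v) = (Y *m v)^t* *m v.
  by rewrite adjmxM YH mulmxA.
rewrite Yv adjmxZ -scalemxAl -scalemxAr => /eqP.
rewrite -subr_eq0 -scalerBl scaler_eq0 subr_eq0 => /orP[/eqP//|/eqP].
by move=> /adjmx_mul_eq0 vE; rewrite vE eqxx in v0.
Qed.

(** Roots of the minimal polynomial come with row eigenvectors; the adjoint of one is a column
    eigenvector, for the same eigenvalue because it is real. *)
Lemma herm_root n (Y : 'M[C]_n.+1) x : Y^t* = Y ->
  root (mxminpoly Y) x <-> exists2 v : 'cV[C]_n.+1, v != 0 & Y *m v = x *: v.
Proof.
move=> YH; rewrite -eigenvalue_root_min; split=> [/eigenvalueP[v vY v0]|[v v0 Yv]].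
  have v0' : v^t* != 0 by apply: contraNneq v0 => vE; rewrite -[v]adjmxK vE trmx0 map_mx0.
  have Yv : Y *m v^t* = x^* *: v^t* by rewrite -{1}YH -adjmxM vY adjmxZ.
  by exists (v^t* ) => //; rewrite Yv -{2}[x]conjCK (herm_eigenvalue_real YH v0' Yv).
apply/eigenvalueP; exists (v^t* ).
  by rewrite -{1}YH -adjmxM Yv adjmxZ (herm_eigenvalue_real YH v0 Yv).
by apply: contraNneq v0 => vE; rewrite -[v]adjmxK vE trmx0 map_mx0.
Qed.

(** By the spectral theorem. Hence the degree of the minimal polynomial counts the distinct
    eigenvalues. *)
Lemma herm_minpoly_split n (Y : 'M[C]_n.+1) : Y^t* = Y ->
  exists2 rs : seq C, uniq rs & mxminpoly Y = \prod_(x <- rs) ('X - x%:P).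
Proof.
move=> YH; have Yn : Y \is normalmx.
  by apply: hermitian_normalmx; apply/is_hermitianmxP; rewrite expr0 scale1r YH.
have Pu := unitarymx_unit (spectral_unitarymx Y).
have YD : diagonalizable_for (spectralmx Y) Y.
  apply/(diagonalizable_forLR Pu); exists (spectral_diag Y).
  by rewrite mxpoly.conjumx ?unitmx_inv // invmxK; move/orthomx_spectralP: Yn.
rewrite (diagonalizable_for_mxminpoly Pu YD).
by eexists; [apply: undup_uniq | reflexivity].
Qed.

(** The distinct roots for [Y], as many as the degree, together with [mu] are all roots for [Z]. *)
Lemma herm_degree_lt n (Y Z : 'M[C]_n.+1) mu : Y^t* = Y ->
  (forall x, root (mxminpoly Y) x -> root (mxminpoly Z) x) ->
  root (mxminpoly Z) mu -> ~~ root (mxminpoly Y) mu ->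
  (degree_mxminpoly Y < degree_mxminpoly Z)%N.
Proof.
move=> YH YZ Zmu Ymu; have [rs urs pE] := herm_minpoly_split YH.
have -> : degree_mxminpoly Y = size rs.
  by apply: succn_inj; rewrite -size_mxminpoly pE size_prod_XsubC.
rewrite -ltnS -size_mxminpoly; apply: (@max_poly_roots _ _ (mu :: rs)).
- by rewrite monic_neq0 // mxminpoly_monic.
- rewrite /= Zmu; apply/allP => x xrs; apply: YZ.
  by rewrite pE root_prod_XsubC.
- by rewrite /= urs andbT; move: Ymu; rewrite pE root_prod_XsubC.
Qed.

(** If the degree were below [m], the coefficients of the minimal polynomial would be a linear
    relation among the rows 1, Y, ..., Y^(m-1). *)
Lemma row_free_powers_degree n m (Y : 'M[C]_n.+1) :
  row_free (powers_mx Y m) -> (m <= degree_mxminpoly Y)%N.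
Proof.
move=> fr; rewrite leqNgt; apply/negP => lt.
have sz : (size (mxminpoly Y) <= m)%N by rewrite size_mxminpoly.
have := horner_rVpoly Y (poly_rV (mxminpoly Y) : 'rV[C]_m).
rewrite poly_rV_K // mx_root_minpoly => /esym/(canRL vec_mxK).
rewrite linear0 -(mul0mx _ (powers_mx Y m)) => /(row_free_inj fr) u0.
have := mxminpoly_monic Y; rewrite -(poly_rV_K sz) u0 linear0.
by rewrite monicE lead_coef0 eq_sym oner_eq0.
Qed.

Lemma exists_real_nonroot (p : {poly C}) : p != 0 -> exists2 x : C, x^* = x & ~~ root p x.
Proof.
move=> p0; apply: contrapT => H.
(* The integers 0, ..., [size p] - 1 are one more than the degree, too many to be all roots. *)
suff : (size [seq (i%:R : C) | i <- iota 0 (size p)] < size p)%N.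
  by rewrite size_map size_iota ltnn.
apply: max_poly_roots => //.
  apply/allP => _ /mapP[i _ ->]; apply/negPn/negP => ri.
  by apply: H; exists i%:R; rewrite ?rmorph_nat.
by rewrite map_inj_uniq ?iota_uniq // => i j /eqP; rewrite eqr_nat => /eqP.
Qed.

Lemma mem_leigenspace n (Y : 'M[C]_n) x (v : 'cV[C]_n) :
  (v \in passmx.leigenspace (linfun (mulmx Y : 'cV[C]_n -> 'cV[C]_n)) x) =
  (Y *m v == x *: v).
Proof.
by rewrite memv_ker add_lfunE opp_lfunE scale_lfunE id_lfunE lfunE /= subr_eq0.
Qed.

End Hermitian.

(** * Subspaces with orthonormal bases as ranges of isometries *)

Section Isometry.
Set Implicit Arguments.
Unset Strict Implicit.
Local Open Scope sesquilinear_scope.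
Context {R : realType}.
Local Notation C := (R[i]).

(** The columns of [T] form an orthonormal basis of [U]; in this form, statements about subspaces
    become matrix identities. *)
Definition isometry_onto d k (T : 'M[C]_(d, k)) (U : {vspace 'cV[C]_d}) :=
  T^t* *m T = 1%:M /\ forall v, v \in U <-> exists w, v = T *m w.

Lemma mulmx_sum_col d k (T : 'M[C]_(d, k)) (w : 'cV[C]_k) :
  T *m w = \sum_i w i 0 *: col i T.
Proof.
apply/colP => i; rewrite mxE summxE; apply: eq_bigr => j _.
by rewrite !mxE mulrC.
Qed.

(** Gram-Schmidt orthonormalization of a basis of [U]. It acts on rows, hence the transposes. *)
Lemma isometry_exists d (U : {vspace 'cV[C]_d}) :
  exists T : 'M[C]_(d, \dim U), isometry_onto T U.
Proof.
pose A : 'M[C]_(\dim U, d) := \matrix_(i, j) (vbasis U)`_i j 0.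
have AE (u : 'rV[C]_(\dim U)) : u *m A = (\sum_i u 0 i *: (vbasis U)`_i)^T.
  apply/rowP => j; rewrite !mxE summxE; apply: eq_bigr => i _.
  by rewrite !mxE.
have Afree : row_free A.
  apply: inj_row_free => u; rewrite AE => /(canRL (@trmxK _ _ _)); rewrite trmx0.
  have /freeP := basis_free (vbasisP U); move=> /[apply] u0.
  by apply/rowP => i; rewrite u0 mxE.
have kd : (\dim U <= d)%N by rewrite -(eqP Afree) rank_leq_col.
pose Q := schmidt A; have QA : (Q :=: A)%MS := eqmx_schmidt_free Afree.
exists Q^T; split.
  have /unitarymxP/(congr1 trmx) := schmidt_unitarymx A kd.
  by rewrite trmx_mul trmx1 map_trmx !trmxK.
have UA v : v \in U <-> (v^T <= A)%MS.
  split=> [vU|/submxP[u vE]].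
    apply/submxP; exists (\row_i coord (vbasis U) i v).
    by rewrite AE {1}(coord_vbasis vU); congr trmx; apply: eq_bigr => i _; rewrite mxE.
  rewrite -[v]trmxK vE AE trmxK; apply: memv_suml => i _; apply: memvZ.
  by apply: vbasis_mem; apply: mem_nth; rewrite size_tuple.
move=> v; split=> [/UA|[w ->]].
  by rewrite -QA => /submxP[u uE]; exists u^T; rewrite -trmx_mul -uE trmxK.
by apply/UA; rewrite -QA trmx_mul trmxK submxMl.
Qed.

Definition basis_mx d k (b : k.-tuple 'cV[C]_d) : 'M[C]_(d, k) :=
  \matrix_(i, j) tnth b j i 0.

Lemma col_basis_mx d k (b : k.-tuple 'cV[C]_d) j : col j (basis_mx b) = tnth b j.
Proof. by apply/colP => i; rewrite !mxE. Qed.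

Lemma basis_mx_isometry d k (b : k.-tuple 'cV[C]_d) U :
  orthonormal_basis U b -> isometry_onto (basis_mx b) U.
Proof.
move=> [bU bon]; split.
  apply/matrixP => i j; rewrite [RHS]mxE -bon !mxE; apply: eq_bigr => l _.
  by rewrite !mxE.
move=> v; split=> [vU|[w ->]].
  exists (\col_i coord b i v); rewrite mulmx_sum_col {1}(coord_basis bU vU).
  by apply: eq_bigr => i _; rewrite col_basis_mx mxE (tnth_nth 0).
rewrite mulmx_sum_col; apply: memv_suml => i _; apply: memvZ.
by rewrite col_basis_mx; apply: (basis_mem bU); apply: mem_tnth.
Qed.

Lemma isometry_basis d (U : {vspace 'cV[C]_d}) (T : 'M[C]_(d, \dim U)) :
  isometry_onto T U -> orthonormal_basis U [tuple col j T | j < \dim U].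
Proof.
move=> [TT UT]; split; last first.
  by move=> i j; have /matrixP/(_ i j) := TT; rewrite !mxE => <-;
     apply: eq_bigr => l _; rewrite !tnth_mktuple !mxE.
rewrite basisEdim size_tuple leqnn andbT; apply/subvP => v /UT[w ->].
rewrite mulmx_sum_col; apply: memv_suml => i _; apply: memvZ.
by apply: memv_span; rewrite -(tnth_mktuple (fun j => col j T)) mem_tnth.
Qed.
End Isometry.

(** * Restriction of a co-representation to an invariant subspace *)

Section Subcorep.
Set Implicit Arguments.
Unset Strict Implicit.
Local Open Scope sesquilinear_scope.
Context {R : realType} {gT : finGroupType} (s : gT -> int).
Local Notation C := (R[i]).
Hypothesis sP : sign_hom s.
Variables (d : nat) (M : gT -> 'M[C]_d) (omega : gT -> gT -> C).
Hypothesis MP : corep s M omega.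

Let MtM g : (M g)^t* *m M g = 1%:M. Proof. by case/(corepP sP): MP. Qed.

(** The relation T N(g) kappa = M(g) kappa T with kappa cancelled on the right. *)
Definition intertwines k (N : gT -> 'M[C]_k) (T : 'M[C]_(d, k)) :=
  forall g, T *m N g = M g *m twist (s g) T.

Lemma invariant_intertwines k (T : 'M[C]_(d, k)) U :
  isometry_onto T U -> corep_invariant s M U ->
  intertwines (fun g => T^t* *m M g *m twist (s g) T) T.
Proof.
move=> [TT UT] inv g; apply: eq_mulmx_col => w.
(* Twisting [w] first makes this vector equal to M(g) twist(T) w, which therefore lies in [U]. *)
have /UT : op s M g (T *m twist (s g) w) \in U.
  by apply: inv; apply/UT; exists (twist (s g) w).
rewrite opE twistM twistK mulmxA => -[w' E].
rewrite -!mulmxA [M g *m (_ *m w)]mulmxA E.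
by rewrite [T^t* *m _]mulmxA TT mul1mx.
Qed.

Section Isometric.
Variables (k : nat) (T : 'M[C]_(d, k)) (N : gT -> 'M[C]_k).
Hypotheses (TT : T^t* *m T = 1%:M) (NT : intertwines N T).

Lemma intertwines_op g v : T *m op s N g v = op s M g (T *m v).
Proof. by rewrite !opE twistM !mulmxA NT. Qed.

Lemma intertwines_unitary g : (N g)^t* *m N g = 1%:M.
Proof.
have <- : (T *m N g)^t* *m (T *m N g) = (N g)^t* *m N g.
  by rewrite adjmxM -mulmxA [T^t* *m _]mulmxA TT mul1mx.
rewrite NT adjmxM -mulmxA [(M g)^t* *m _]mulmxA MtM mul1mx.
by rewrite -twist_adj -twistM TT twist1.
Qed.

(** The relations for [M] are pulled back along [T], which is cancelled by its adjoint; the factor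
    system is therefore the same. *)
Lemma intertwines_corep : corep s N omega.
Proof.
have [w1 _ MM] := (corepP sP M omega).1 MP.
apply/(corepP sP); split=> // [|g h]; first exact: intertwines_unitary.
rewrite -[LHS]mul1mx -[RHS]mul1mx -TT -!mulmxA; congr (_ *m _).
rewrite mulmxA NT -mulmxA -twistM NT twistM mulmxA MM.
by rewrite (twist_signM sP) -scalemxAl -NT -scalemxAr.
Qed.

(** Since N(g) is unitary, T equals M(g) twist(T) times the adjoint of N(g); that adjoint is then
    absorbed into the adjoint of [T]. *)
Lemma intertwines_projection : commutes s M (T *m T^t*).
Proof.
move=> g; have NN : N g *m (N g)^t* = 1%:M by exact: mulmx1C (intertwines_unitary g).
have TE : T = M g *m twist (s g) T *m (N g)^t* by rewrite -NT -mulmxA NN mulmx1.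
rewrite {1}TE -!mulmxA; congr (_ *m _); rewrite twistM; congr (_ *m _).
rewrite mulmxA -adjmxM NT adjmxM -mulmxA MtM mulmx1.
by rewrite twist_adj.
Qed.

Lemma intertwines_comp j (T' : 'M[C]_(k, j)) (N' : gT -> 'M[C]_j) :
  (forall g, T' *m N' g = N g *m twist (s g) T') -> intertwines N' (T *m T').
Proof. by move=> NT' g; rewrite -mulmxA NT' mulmxA NT -mulmxA -twistM. Qed.

End Isometric.

(** Column by column, this is the expansion of the image of a basis vector in the basis. *)
Lemma corep_in_basis_intertwines k (b : k.-tuple 'cV[C]_d) U :
  orthonormal_basis U b -> corep_invariant s M U ->
  intertwines (corep_in_basis s M b) (basis_mx b).
Proof.
move=> bU inv g; have [TT UT] := basis_mx_isometry bU; case: bU => bU _.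
apply/matrixP => i j; rewrite mxE.
transitivity ((op s M g (tnth b j)) i 0).
  rewrite [in RHS](coord_basis bU (inv g _ _)); last first.
    by apply: (basis_mem bU); apply: mem_tnth.
  rewrite summxE; apply: eq_bigr => l _.
  by rewrite !mxE (tnth_nth 0) mulrC.
rewrite opE -col_basis_mx; set T := basis_mx b.
rewrite [twist _ (col j T)](_ : _ = col j (twist (s g) T)).
  by rewrite !colE mulmxA -colE mxE.
by rewrite /twist; case: ifP => // _; rewrite map_col.
Qed.


End Subcorep.

(** * A maximal number of eigenvalues forces irreducible eigenspaces *)

Section Maximal.
Set Implicit Arguments.
Unset Strict Implicit.
Local Open Scope sesquilinear_scope.
Context {R : realType} {gT : finGroupType} (s : gT -> int).
Local Notation C := (R[i]).
Hypothesis sP : sign_hom s.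
Variables (n : nat) (M : gT -> 'M[C]_n.+1) (omega : gT -> gT -> C).
Hypothesis MP : corep s M omega.

Lemma maximal_degree_irreducible (H : 'M[C]_n.+1) (lambda : C) k
    (T : 'M[C]_(n.+1, k)) (N : gT -> 'M[C]_k) (E : {vspace 'cV[C]_n.+1}) :
  H^t* = H -> commutes s M H ->
  (forall Y, Y^t* = Y -> commutes s M Y ->
    (degree_mxminpoly Y <= degree_mxminpoly H)%N) ->
  lambda^* = lambda -> (forall v, v \in E <-> H *m v = lambda *: v) ->
  isometry_onto T E -> intertwines s M N T ->
  forall U : {vspace 'cV[C]_k}, corep_invariant s N U -> U = 0%VS \/ U = fullv.
Proof.
move=> HH HM Hmax lR Eeig [TT ET] NT U Uinv.
have HT : H *m T = lambda *: T.
  apply: eq_mulmx_col => w; rewrite -mulmxA -scalemxAl; apply/Eeig/ET.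
  by exists w.
have NP := intertwines_corep sP MP TT NT.
have [T' T'U] := isometry_exists U; have [TT' UT'] := T'U.
(* [S] is an isometry onto the copy of [U] inside [E]; with its adjoint it gives the orthogonal
   projection onto that copy. *)
set S := T *m T'; pose N' g := T'^t* *m N g *m twist (s g) T'.
have SN : intertwines s M N' S.
  exact: intertwines_comp (invariant_intertwines T'U Uinv).
have SS : S^t* *m S = 1%:M.
  by rewrite /S adjmxM -mulmxA [T^t* *m _]mulmxA TT mul1mx.
have HS : H *m S = lambda *: S by rewrite mulmxA HT -scalemxAl.
(* The new eigenvalue must be real for [Y] to be Hermitian and to commute with the antilinear
   operators. *)
have [mu muR mu_root] := exists_real_nonroot (monic_neq0 (mxminpoly_monic H)).
set Y := H + (mu - lambda) *: (S *m S^t*).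
have cR : (mu - lambda)^* = mu - lambda by rewrite rmorphB /= muR lR.
have YH : Y^t* = Y by rewrite adjmxD adjmxZ cR HH adjmxM adjmxK.
have YM : commutes s M Y.
  move=> g; rewrite twistD mulmxDl mulmxDr HM twist_realZ //.
  by rewrite -scalemxAl -scalemxAr (intertwines_projection sP MP SS SN).
have YE v : Y *m v = H *m v + (mu - lambda) *: (S *m (S^t* *m v)).
  by rewrite mulmxDl -scalemxAl !mulmxA.
have [->|U0] := eqVneq U 0%VS; first by left.
have [->|UF] := eqVneq U fullv; first by right.
suff : (degree_mxminpoly H < degree_mxminpoly Y)%N by rewrite ltnNge Hmax.
apply: (@herm_degree_lt _ _ H Y mu HH _ _ mu_root).
- move=> x /(herm_root _ HH)[v v0 Hv]; apply/(herm_root _ YH).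
  (* The eigenvalue [lambda] survives on the part of [E] orthogonal to the copy of [U], nonzero
     because [U] is proper. *)
  have [xl|xl] := eqVneq x lambda.
    have [w wU] : exists w, w \notin U.
      apply: contrapT => allU; case/eqP: UF; apply/vspaceP => w; rewrite memvf.
      by apply/negPn/negP => wU; apply: allU; exists w.
    pose w' := w - T' *m (T'^t* *m w).
    have w'0 : T'^t* *m w' = 0 by rewrite mulmxBr mulmxA TT' mul1mx subrr.
    have w'N0 : w' != 0.
      by apply: contraNneq wU => /subr0_eq wE; apply/UT'; eexists; exact: wE.
    exists (T *m w').
      by apply: contraNneq w'N0 => Tw; rewrite -[w']mul1mx -TT -mulmxA Tw mulmx0.
    rewrite YE /S adjmxM -[T'^t* *m _ *m _]mulmxA [T^t* *m _]mulmxA TT mul1mx w'0.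
    by rewrite mulmx0 scaler0 addr0 mulmxA HT -scalemxAl xl.
  (* Eigenvectors of [H] for other eigenvalues are orthogonal to the range of [S], so the
     perturbation kills them. *)
  exists v => //; suff Sv : S^t* *m v = 0 by rewrite YE Sv mulmx0 scaler0 addr0.
  have : S^t* *m (H *m v) = (H *m S)^t* *m v by rewrite adjmxM HH mulmxA.
  rewrite Hv HS adjmxZ lR -scalemxAr -scalemxAl => /eqP.
  by rewrite -subr_eq0 -scalerBl scaler_eq0 subr_eq0 (negPf xl) => /eqP.
- apply/(herm_root _ YH).
  (* Any nonzero vector in the range of [S] is an eigenvector of [Y] for [mu]; one exists because
     [U] is nonzero. *)
  have u0 := U0; rewrite -vpick0 in u0.
  have /UT'[z zE] := memv_pick U; exists (S *m z).
    apply: contraNneq u0 => Sz.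
    by rewrite zE -[z]mul1mx -SS -mulmxA Sz !mulmx0.
  rewrite YE [S^t* *m _]mulmxA SS mul1mx mulmxA HS -scalemxAl -scalerDl.
  by rewrite addrC subrK.
Qed.
End Maximal.

(** * Large degree of the minimal polynomial is a generic condition *)

Section Generic.
Set Implicit Arguments.
Unset Strict Implicit.
Local Open Scope sesquilinear_scope.
Context {R : realType}.
Local Notation C := (R[i]).
Local Notation Rn n := (n.-tuple (measurableTypeR R)).

Definition mx_poly_fun n p q (F : Rn n -> 'M[C]_(p, q)) :=
  forall i j, poly_fun (fun t => F t i j).

Section Operations.
Variable n : nat.

Lemma mx_poly_fun_cst p q (A : 'M[C]_(p, q)) : mx_poly_fun (fun _ : Rn n => A).
Proof. by move=> i j; apply: poly_fun_cst. Qed.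

Lemma mx_poly_funD p q (F G : Rn n -> 'M[C]_(p, q)) :
  mx_poly_fun F -> mx_poly_fun G -> mx_poly_fun (fun t => F t + G t).
Proof.
by move=> PF PG i j; under eq_fun do rewrite mxE; apply: poly_funD.
Qed.

Lemma mx_poly_funM p q r (F : Rn n -> 'M[C]_(p, q)) (G : Rn n -> 'M[C]_(q, r)) :
  mx_poly_fun F -> mx_poly_fun G -> mx_poly_fun (fun t => F t *m G t).
Proof.
move=> PF PG i j; under eq_fun do rewrite mxE.
by apply: poly_fun_sum => k _; apply: poly_funM.
Qed.

Lemma mx_poly_fun_sum p q (I : finType) (F : I -> Rn n -> 'M[C]_(p, q)) :
  (forall k, mx_poly_fun (F k)) -> mx_poly_fun (fun t => \sum_k F k t).
Proof.
by move=> PF i j; under eq_fun do rewrite summxE; apply: poly_fun_sum => k _; apply: PF.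
Qed.

Lemma mx_poly_fun_adj p q (F : Rn n -> 'M[C]_(p, q)) :
  mx_poly_fun F -> mx_poly_fun (fun t => (F t)^t*).
Proof. by move=> PF i j; under eq_fun do rewrite !mxE; apply: poly_fun_conj. Qed.

Lemma mx_poly_fun_twist e p q (F : Rn n -> 'M[C]_(p, q)) :
  mx_poly_fun F -> mx_poly_fun (fun t => twist e (F t)).
Proof.
move=> PF; rewrite /twist; case: (e == 1) => // i j.
by under eq_fun do rewrite mxE; exact: (poly_fun_conj (PF i j)).
Qed.

Lemma mx_poly_fun_powers p m (F : Rn n -> 'M[C]_p.+1) :
  mx_poly_fun F -> mx_poly_fun (fun t => powers_mx (F t) m).
Proof.
move=> PF i j; case/mxvec_indexP: j => a b.
under eq_fun do rewrite mxE mxvecE.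
elim: (nat_of_ord i) a b => [|k IH] a b.
  by under eq_fun do rewrite expr0; apply: poly_fun_cst.
under eq_fun do rewrite exprS.
by apply: mx_poly_funM.
Qed.

Lemma mx_poly_fun_det p (F : Rn n -> 'M[C]_p) :
  mx_poly_fun F -> poly_fun (fun t => \det (F t)).
Proof.
move=> PF; apply: poly_fun_sum => sigma _; apply: poly_funM.
  exact: poly_fun_cst.
by apply: poly_fun_prod => i; apply: PF.
Qed.
End Operations.

Lemma mx_of_coords_poly d : mx_poly_fun (@mx_of_coords R d).
Proof.
move=> i j; rewrite (_ : (fun _ => _) =
  (fun t => (tnth t (lshift (d * d) (mxvec_index i j)) : R)%:C%C +
    'i%C * (tnth t (rshift (d * d) (mxvec_index i j)) : R)%:C%C)).
  apply: poly_funD; first exact: poly_fun_coord.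
  by apply: poly_funM; [apply: poly_fun_cst | apply: poly_fun_coord].
by apply/funext => t; rewrite mxE [LHS]complexE.
Qed.

Lemma mx_of_coords_surj d (X : 'M[C]_d) : exists t, mx_of_coords t = X.
Proof.
exists [tuple match fintype.split k with
  | inl l => complex.Re (mxvec X 0 l)
  | inr l => complex.Im (mxvec X 0 l) end | k < d * d + d * d].
apply/matrixP => i j; rewrite mxE !tnth_mktuple.
rewrite -[lshift _ _]/(unsplit (inl _)) -[rshift _ _]/(unsplit (inr _)) !unsplitK.
by rewrite mxvecE; case: (X i j).
Qed.

(** The degree at [X0] is attained or exceeded wherever one determinant, polynomial in the
    coordinates, is nonzero. *)
Lemma maximal_degree_ae d (F : 'M[C]_d.+1 -> 'M[C]_d.+1) (P : 'M[C]_d.+1 -> Prop) X0 :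
  mx_poly_fun (fun t => F (mx_of_coords t)) ->
  (forall X, (degree_mxminpoly (F X0) <= degree_mxminpoly (F X))%N -> P X) ->
  for_almost_all_mx P.
Proof.
move=> PF FP; set m := degree_mxminpoly _ in FP.
(* A right inverse [B] of the matrix of powers at [X0] is kept fixed: the determinant of the powers
   times [B] is 1 at [X0], and where it is nonzero the powers are independent. *)
have [B B1] := row_freeP (minpoly_mx_free (F X0)).
have [t0 t0E] := mx_of_coords_surj X0.
apply: (@poly_fun_nonzero_ae _ _
  (fun t => \det (powers_mx (F (mx_of_coords t)) m *m B)) _ t0).
- apply: mx_poly_fun_det; apply: mx_poly_funM; last exact: mx_poly_fun_cst.
  exact: mx_poly_fun_powers.
- by rewrite t0E B1 det1 oner_eq0.
move=> t; rewrite -unitfE -unitmxE => U; apply: FP; apply: row_free_powers_degree.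
apply/row_freeP; exists (B *m invmx (powers_mx (F (mx_of_coords t)) m *m B)).
by rewrite mulmxA mulmxV.
Qed.
End Generic.

(** * Existence of a maximal element, and the conclusion *)

Section Assembly.
Set Implicit Arguments.
Unset Strict Implicit.
Local Open Scope sesquilinear_scope.
Context {R : realType} {gT : finGroupType} (s : gT -> int).
Local Notation C := (R[i]).
Hypothesis sP : sign_hom s.
Variable omega : gT -> gT -> C.

Lemma calH_poly d (M : gT -> 'M[C]_d) : corep s M omega ->
  mx_poly_fun (fun t => calH s M (mx_of_coords t)).
Proof.
move=> MP; under eq_fun do rewrite (calH_mx MP).
apply: mx_poly_fun_sum => g.
apply: mx_poly_funM; last exact: mx_poly_fun_cst.
apply: mx_poly_funM; first exact: mx_poly_fun_cst.
apply: mx_poly_fun_twist; apply: mx_poly_funD; first exact: mx_of_coords_poly.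
by apply: mx_poly_fun_adj; exact: mx_of_coords_poly.
Qed.

Lemma exists_maximal_degree d (M : gT -> 'M[C]_d.+1) : exists2 H,
  H^t* = H /\ commutes s M H &
  forall Y, Y^t* = Y -> commutes s M Y ->
    (degree_mxminpoly Y <= degree_mxminpoly H)%N.
Proof.
pose Q m := `[< exists Y, [/\ Y^t* = Y, commutes s M Y & degree_mxminpoly Y = m] >].
have Q0 : exists m, Q m.
  exists (degree_mxminpoly (0 : 'M[C]_d.+1)); apply/asboolP; exists 0.
  by split=> //; [rewrite trmx0 map_mx0 | move=> g; rewrite mul0mx twist0 mulmx0].
have Qb m : Q m -> (m <= d.+1)%N.
  (* Cayley-Hamilton bounds the degree by the dimension. *)
  move=> /asboolP[Y [_ _ <-]]; rewrite -ltnS -size_mxminpoly -(size_char_poly Y).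
  by apply: dvdp_leq (mxminpoly_dvd_char Y); rewrite monic_neq0 // char_poly_monic.
case: (ex_maxnP Q0 Qb) => m /asboolP[H [HH HM Hm]] Hmax.
exists H; [exact: conj HH HM | move=> Y YH YM; rewrite Hm; apply: Hmax; apply/asboolP].
by exists Y; constructor.
Qed.

(** Only irreducibility depends on [H] being generic; it enters as a hypothesis, so that dimension
    zero and positive dimension share the rest. *)
Lemma commuting_herm_eigenspaces d (M : gT -> 'M[C]_d) (H : 'M[C]_d) :
  corep s M omega -> H^t* = H -> commutes s M H ->
  let fH := linfun (mulmx H : 'cV[C]_d -> 'cV[C]_d) in
  (forall lambda k (T : 'M[C]_(d, k)) (N : gT -> 'M[C]_k), lambda^* = lambda ->
    passmx.leigenvalue fH lambda ->
    isometry_onto T (passmx.leigenspace fH lambda) -> intertwines s M N T ->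
    forall U : {vspace 'cV[C]_k}, corep_invariant s N U -> U = 0%VS \/ U = fullv) ->
  [/\ H \is hermsymmx,
      forall g v, H *m op s M g v = op s M g (H *m v)
    & forall lambda : C, passmx.leigenvalue fH lambda ->
        let E := passmx.leigenspace fH lambda in
        [/\ corep_invariant s M E,
            exists b : (\dim E).-tuple 'cV[C]_d, orthonormal_basis E b
          & forall b : (\dim E).-tuple 'cV[C]_d, orthonormal_basis E b ->
              let N := corep_in_basis s M b in
              [/\ corep s N omega, corep_irreducible s N & corep_contained s N M]]].
Proof.
move=> MP HH HM fH irr.
have Hop g v : H *m op s M g v = op s M g (H *m v).
  by rewrite !opE twistM !mulmxA HM.
split=> // [|lambda eig E].
  by apply/is_hermitianmxP; rewrite expr0 scale1r HH.
(* An antilinear operator commuting with [H] sends the eigenspace of [lambda] to that of its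
   conjugate, so invariance rests on [lambda] being real. *)
have lR : lambda^* = lambda.
  have := eig; rewrite /passmx.leigenvalue -vpick0 => v0.
  have := memv_pick (passmx.leigenspace fH lambda).
  by rewrite mem_leigenspace => /eqP; apply: herm_eigenvalue_real.
have inv : corep_invariant s M E.
  move=> g v; rewrite !mem_leigenspace => /eqP Hv.
  by rewrite Hop Hv !opE twist_realZ // -scalemxAr.
split=> // [|b bE N].
  by have [T /isometry_basis] := isometry_exists E; eexists; eassumption.
have TE := basis_mx_isometry bE.
have NT : intertwines s M N (basis_mx b) := corep_in_basis_intertwines bE inv.
split.
- by case: TE => TT _; apply: (intertwines_corep sP MP TT NT).
- split; last exact: irr TE NT.
  by rewrite lt0n dimv_eq0.
- exists E, (basis_mx b); case: TE => TT ET; split=> //.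
    apply/vspaceP => v; apply/idP/idP => [/memv_imgP[w _ ->]|/ET[w ->]].
      by rewrite lfunE; apply/ET; exists w.
    by apply/memv_imgP; exists w; rewrite ?memvf ?lfunE.
  by move=> g v; apply: intertwines_op.
Qed.
End Assembly.

Theorem theorem1 (R : realType) (gT : finGroupType) (s : gT -> int)
    (d : nat) (omega : gT -> gT -> R[i]) (M : gT -> 'M[R[i]]_d) :
  sign_hom s ->
  corep s M omega ->
  for_almost_all_mx (fun X : 'M[R[i]]_d =>
    let H := calH s M X in
    let fH := linfun (mulmx H : 'cV[R[i]]_d -> 'cV[R[i]]_d) in
    [/\ H \is hermsymmx,
        forall g v, H *m op s M g v = op s M g (H *m v)
      & forall lambda : R[i], passmx.leigenvalue fH lambda ->
          let E := passmx.leigenspace fH lambda in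
          [/\ corep_invariant s M E,
              exists b : (\dim E).-tuple 'cV[R[i]]_d, orthonormal_basis E b
            & forall b : (\dim E).-tuple 'cV[R[i]]_d, orthonormal_basis E b ->
                let N := corep_in_basis s M b in
                [/\ corep s N omega, corep_irreducible s N & corep_contained s N M]]]).
Proof.
move=> sP MP; case: d M MP => [|n] M MP.
  (* In dimension zero there are no eigenvalues and every [X] qualifies, as the constant polynomial
     1 records. *)
  apply: (@poly_fun_nonzero_ae _ _ (fun=> 1) _ [tuple 0 | _ < _]).
  - exact: poly_fun_cst.
  - exact: oner_neq0.
  move=> t _; apply: commuting_herm_eigenspaces
    (calH_adj MP _) (calH_commutes sP MP _) _ => //.
  move=> lambda k T N _ /negP[]; rewrite -vpick0; apply/eqP/matrixP; case=> //.
have [Y [YH YM] Ymax] := exists_maximal_degree s M.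
(* Surjectivity of the averaging realizes the maximal degree at some [X0]; almost every [X] then
   attains it too. *)
have [X0 X0Y] := calH_onto sP MP YH YM.
apply: (@maximal_degree_ae _ _ (calH s M) _ X0 (calH_poly MP)) => X.
rewrite X0Y => Xmax.
apply: commuting_herm_eigenspaces (calH_adj MP _) (calH_commutes sP MP _) _ => //.
move=> lambda k T N lR _; apply: (maximal_degree_irreducible sP MP
  (calH_adj MP X) (calH_commutes sP MP X) _ lR) => [Z ZH ZM|v].
  by apply: leq_trans Xmax; apply: Ymax.
by rewrite mem_leigenspace; split=> /eqP.
Qed.
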